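(* Let $(\Omega,d)$ be a totally bounded metric space and let $X=\{X(t)\}_{t\in[0,1]}$ be an $\Omega$-valued stochastic process with metric auto-covariance function $C(s,t)=\mathrm{Cov}_\Omega(X(s),X(t))$, $s,t\in[0,1]$. If $\Omega$ is separable and $d^2$ is of negative type, then $C$ is a nonnegative definite kernel, i.e. $C$ is symmetric and for every positive integer $k$, all $a_1,\dots,a_k\in\mathbb{R}$ and all $s_1,\dots,s_k\in[0,1]$, $$\sum_{i=1}^k\sum_{j=1}^k a_ia_j\,C(s_i,s_j)\ \ge 0 .$$
   Context: Metric covariance: for a pair $(U,V)$ of $\Omega$-valued random variables and an i.i.d. copy $(U',V')$ of $(U,V)$, $$\mathrm{Cov}_\Omega(U,V)=\tfrac14 E\big(d^2(U,V')+d^2(U',V)-2d^2(U,V)\big).$$ Negative type: the semimetric $\rho=d^2$ on $\Omega$ is of negative type if for all $n\ge 2$, all $z_1,\dots,z_n\in\Omega$ and all $\alpha_1,\dots,\alpha_n\in\mathbb{R}$ with $\sum_{i=1}^n\alpha_i=0$ one has $\sum_{i=1}^n\sum_{j=1}^n\alpha_i\alpha_j\,\rho(z_i,z_j)\le 0$. *)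

(* Defs.v *)
From HB Require Import structures.
From mathcomp Require Import all_boot all_order all_algebra.
From mathcomp Require Import all_classical all_reals all_analysis.

Set Implicit Arguments.
Unset Strict Implicit.
Unset Printing Implicit Defensive.

Import Order.TTheory GRing.Theory Num.Theory.
Import numFieldNormedType.Exports.

Local Open Scope classical_set_scope.
Local Open Scope ring_scope.

(* [measurableType] requires a distinguished point, hence so does the state
   space of a process. This only excludes the empty space, on which there is
   no random variable anyway. *)
#[short(type="pmetricType")]
HB.structure Definition PointedMetric (K : numDomainType) :=
  {M of Pointed M & Metric K M}.

Notation borel_type M := (g_sigma_algebraType (@open M)).

Definition totally_bounded_space (R : realType) (M : metricType R) : Prop :=
  forall e : R, 0 < e ->
    exists2 F : set M, finite_set F & \bigcup_(x in F) ball x e = [set: M].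

Definition separable_space (T : topologicalType) : Prop :=
  exists2 D : set T, countable D & dense D.

Definition negative_type (R : realType) (M : Type) (rho : M -> M -> R) : Prop :=
  forall n : nat, (2 <= n)%N ->
  forall (z : 'I_n -> M) (alpha : 'I_n -> R), \sum_(i < n) alpha i = 0 ->
    \sum_(i < n) \sum_(j < n) alpha i * alpha j * rho (z i) (z j) <= 0.

Definition sqdist (R : realType) (M : metricType R) (x y : M) : R :=
  mdist x y ^+ 2.

Definition nonneg_def_kernel (R : realType) (I : Type) (C : I -> I -> R)
    : Prop :=
  (forall s t, C s t = C t s) /\
  (forall k : nat, (0 < k)%N -> forall (a : 'I_k -> R) (s : 'I_k -> I),
    0 <= \sum_(i < k) \sum_(j < k) a i * a j * C (s i) (s j)).

Definition iid_copy (d d' : measure_display) (S : measurableType d)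
    (E : measurableType d') (R : realType) (Q : probability S R)
    (W W' : S -> E) : Prop :=
  [/\ measurable_fun setT W, measurable_fun setT W',
      forall A : set E, measurable A -> Q (W' @^-1` A) = Q (W @^-1` A) &
      forall A B : set E, measurable A -> measurable B ->
        Q (W @^-1` A `&` W' @^-1` B) = (Q (W @^-1` A) * Q (W' @^-1` B))%E].

(* The expression defining the metric covariance, for a given copy (U', V')
   of (U, V) living on the same probability space as (U, V). *)
Definition metric_cov_with (d : measure_display) (S : measurableType d)
    (R : realType) (M : metricType R) (Q : probability S R)
    (U V U' V' : S -> M) : R :=
  4^-1 * fine 'E_Q[fun w => sqdist (U w) (V' w) + sqdist (U' w) (V w)
                            - 2 * sqdist (U w) (V w)].

(* The probability space carrying (U, V) need not support an independent copy
   of (U, V), so it is squared: (U, V) is read on the first factor, and the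
   copy (U', V') is (U, V) read on the second one, see [iid_copy_prod]. *)
Definition metric_cov (d : measure_display) (T : measurableType d)
    (R : realType) (M : metricType R) (P : probability T R)
    (U V : T -> M) : R :=
  @metric_cov_with _ (T * T)%type R M (P \x P)%E
    (U \o fst) (V \o fst) (U \o snd) (V \o snd).

Lemma iid_copy_prod (d d' : measure_display) (T : measurableType d)
    (E : measurableType d') (R : realType) (P : probability T R) (W : T -> E) :
  measurable_fun setT W ->
  @iid_copy _ _ (T * T)%type E R (P \x P)%E (W \o fst) (W \o snd).
Proof.
move=> mW.
have mpre A : measurable A -> measurable (W @^-1` A).
  by move=> mA; rewrite -[X in measurable X]setTI; exact: mW.
pose Q : probability (T * T)%type R := (P \x P)%E.
have QX A B : measurable A -> measurable B ->
    Q (A `*` B) = (P A * P B)%E by exact: product_measure1E.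
have Q1 A : measurable A -> Q ((W \o fst) @^-1` A) = P (W @^-1` A).
  move=> mA; rewrite -[RHS]mule1 -(probability_setT P) -QX//; last exact: mpre.
  by congr (Q _); apply/seteqP; split => -[x y] //= [].
have Q2 A : measurable A -> Q ((W \o snd) @^-1` A) = P (W @^-1` A).
  move=> mA; rewrite -[RHS]mul1e -(probability_setT P) -QX//; last exact: mpre.
  by congr (Q _); apply/seteqP; split => -[x y] //= [].
split.
- exact: measurableT_comp.
- exact: measurableT_comp.
- by move=> A mA; rewrite (Q1 A mA); exact: Q2.
- move=> A B mA mB; rewrite (Q1 A mA) (Q2 B mB).
  by rewrite -QX; [congr (Q _)|exact: mpre|exact: mpre].
Qed.

(* Random elements are measurable for the Borel sigma-algebra of [M]. *)
Definition metric_autocov (d : measure_display) (T : measurableType d)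
    (R : realType) (M : pmetricType R) (P : probability T R) (I : Type)
    (X : I -> {RV P >-> borel_type M}) (s t : I) : R :=
  metric_cov P (X s : T -> M) (X t : T -> M).

(* Main.v *)
(** Since [(U, V)] and its copy [(U', V')] have the same law, one of the two
    terms [d^2(U, V)] may be replaced by [d^2(U', V')]. This turns the quadratic
    form of [4 C] into the expectation of
    [sum_ij a_i a_j (rho(x_i, x'_j) + rho(x'_i, x_j) - rho(x_i, x_j)
    - rho(x'_i, x'_j))], where [rho = d^2]. Pointwise, this is the negative of
    the form of [rho] at the [2k] points [x_1 .. x_k, x'_1 .. x'_k] with weights
    [a_1 .. a_k, -a_1 .. -a_k], which sum to zero, so it is nonnegative by
    negative type. Separability makes [d(U, V)] measurable for the Borel
    sigma-algebra and total boundedness makes it bounded, hence all the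
    expectations are finite. *)
Require Import Defs.
From mathcomp Require Import all_boot all_order all_algebra.
From mathcomp Require Import all_classical all_reals all_analysis.
From mathcomp Require Import measurable_realfun ring lra.

Set Implicit Arguments.
Unset Strict Implicit.
Unset Printing Implicit Defensive.

Import Order.TTheory GRing.Theory Num.Theory.
Import numFieldNormedType.Exports.

Local Open Scope classical_set_scope.
Local Open Scope ring_scope.

Lemma sqdistC (R : realType) (M : metricType R) (x y : M) :
  sqdist x y = sqdist y x.
Proof. by rewrite /sqdist metric_sym. Qed.

Lemma metric_ball_open (R : realType) (M : metricType R) (x : M) (r : R) :
  open (ball x r).
Proof.
rewrite openE => y; rewrite ballEmdist/= => xy.
apply/nbhs_ballP; exists (r - mdist x y) => /=; first by rewrite subr_gt0.
move=> z; rewrite !ballEmdist/= ltrBrDl => h.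
exact: le_lt_trans (metric_triangle x y z) h.
Qed.

(** Borel sets of the square of a metric space may go beyond the product sigma-algebra, so
    continuity of the distance is not enough. A countable dense set reduces each event [mdist < r]
    to countably many rectangles. *)
Lemma measurable_mdist (R : realType) (M : pmetricType R)
    (d : measure_display) (S : measurableType d) (U V : S -> borel_type M) :
  separable_space M -> measurable_fun setT U -> measurable_fun setT V ->
  measurable_fun setT (fun w => mdist (U w : M) (V w : M)).
Proof.
move=> [D /pcard_surjP[g gD] dD] mU mV.
have tri (x y z : M) : mdist x z <= mdist x y + mdist y z.
  exact: metric_triangle.
have symm (x y : M) : mdist x y = mdist y x by exact: metric_sym.
have mball (W : S -> borel_type M) x r : measurable_fun setT W ->
    measurable (W @^-1` (ball (x : M) r)).
  move=> mW; rewrite -[X in measurable X]setTI; apply: mW => //.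
  by apply: sub_sigma_algebra; exact: metric_ball_open.
move=> mT; apply: (measurability _ (RGenInftyO.measurableE R)) => //.
move=> _ [_ [r ->] <-]; rewrite setTI.
(* The distance is below [r] exactly when, for some e = 1/(k+1), some [g n] lies within e of [U w]
   and within [r - e] of [V w]. *)
rewrite (_ : _ @^-1` _ = \bigcup_n \bigcup_k
    (U @^-1` ball (g n) k.+1%:R^-1 `&` V @^-1` ball (g n) (r - k.+1%:R^-1))).
  apply: bigcupT_measurable => n; apply: bigcupT_measurable => k.
  by apply: measurableI; exact: mball.
apply/seteqP; split => w /=; rewrite in_itv/=.
- move=> UVr.
  (* For e below half the slack, a point z within e of U has d(z, V) < e + d(U, V) < r - e. *)
  have e0 : 0 < (r - mdist (U w : M) (V w)) / 2 by rewrite divr_gt0// subr_gt0.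
  have [k _ /(_ k (leqnn k)) ke] := near_infty_natSinv_lt (PosNum e0).
  have {}ke : k.+1%:R^-1 < (r - mdist (U w : M) (V w)) / 2 := ke.
  have [] := dD (ball (U w : M) k.+1%:R^-1).
  + by exists (U w); rewrite ballEmdist/= mdistxx.
  + exact: metric_ball_open.
  move=> z [zU /gD[n _ gnz]].
  exists n => //; exists k => //.
  move: zU; rewrite -gnz !ballEmdist/= symm => zU; split => //.
  have := tri (g n) (U w) (V w).
  move: zU ke; set e := _^-1.
  lra.
- move=> [n _ [k _]]; rewrite !ballEmdist/= symm => -[].
  have := tri (U w) (g n) (V w).
  set e := _^-1.
  lra.
Qed.

Lemma totally_bounded_mdist (R : realType) (M : pmetricType R) :
  totally_bounded_space M -> exists B : R, forall x y : M, mdist x y <= B.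
Proof.
move=> /(_ 1 ltr01)[_ /finite_seqP[s ->] sM].
(* [s] lists the centres of a finite cover by unit balls, so every point is within [B + 1] of the
   base point and the diameter is at most twice that. *)
pose B := \big[Num.max/0]_(z <- s) mdist (point : M) z.
have tri (x y z : M) : mdist x z <= mdist x y + mdist y z.
  exact: metric_triangle.
have pB (x : M) : mdist point x <= B + 1.
  have : [set: M] x by [].
  rewrite -sM => -[z /= zs]; rewrite ballEmdist/= => zx.
  have zB : mdist point z <= B by exact: le_bigmax_seq.
  have := tri point z x; lra.
exists ((B + 1) + (B + 1)) => x y.
apply: (le_trans (tri x point y)).
by rewrite lerD// metric_sym.
Qed.

Lemma integrable_sqdist (R : realType) (M : pmetricType R)
    (d : measure_display) (S : measurableType d) (Q : probability S R)
    (U V : S -> borel_type M) :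
  totally_bounded_space M -> separable_space M ->
  measurable_fun setT U -> measurable_fun setT V ->
  Q.-integrable setT (EFin \o (fun w => sqdist (U w : M) (V w : M))).
Proof.
move=> /totally_bounded_mdist[B UB] sep mU mV.
apply: measurable_bounded_integrable => //.
- by rewrite (le_lt_trans (probability_le1 _ _))// ltry.
- by apply: measurable_funX; exact: measurable_mdist.
exists (B ^+ 2); split; first exact: num_real.
move=> x Bx w _ /=; rewrite ger0_norm; last by rewrite exprn_ge0// mdist_ge0.
(* Squaring the bound needs [0 <= B], which follows from [0 <= mdist (U w) (V w) <= B]. *)
apply: le_trans (ltW Bx); rewrite lerXn2r// ?nnegrE ?mdist_ge0//.
exact: le_trans (mdist_ge0 _ _) (UB (U w) (V w)).
Qed.

(** Tonelli in the two opposite orders yields the same iterated integral, since both factors are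
    [P]. This is the equality in law of a pair and its copy, in the form used below. *)
Lemma Rintegral_prod_fst_snd (R : realType) (d : measure_display)
    (T : measurableType d) (P : probability T R) (f : T -> R) :
  measurable_fun setT f -> (forall x, 0 <= f x) ->
  \int[(P \x P)%E]_w f w.1 = \int[(P \x P)%E]_w f w.2.
Proof.
move=> mf f0; rewrite /Rintegral; congr fine.
rewrite (fubini_tonelli1 (fun w => (f w.1)%:E)); last 2 first.
- by apply/measurable_EFinP; exact: measurableT_comp.
- by move=> w; rewrite lee_fin.
rewrite (fubini_tonelli2 (fun w => (f w.2)%:E)) //.
- by apply/measurable_EFinP; exact: measurableT_comp.
- by move=> w; rewrite lee_fin.
Qed.

Lemma Rintegral_sum (R : realType) (d : measure_display) (T : measurableType d)
    (mu : measure T R) (I : Type) (s : seq I) (f : I -> T -> R) :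
  (forall i, mu.-integrable setT (EFin \o f i)) ->
  \int[mu]_x (\sum_(i <- s) f i x) = \sum_(i <- s) \int[mu]_x f i x.
Proof.
move=> fi; rewrite /Rintegral.
under eq_integral do rewrite -sumEFin.
rewrite integral_sum// -sum_fine// => i _.
exact: (integrable_fin_num _ (fi i)).
Qed.

(** The integrand of four times the covariance, after one [rho x y] is traded for its copy
    [rho x' y']. *)
Definition cross_gap (R : realType) (M : Type) (rho : M -> M -> R)
    (x y x' y' : M) : R :=
  rho x y' + rho x' y - rho x y - rho x' y'.

Lemma negative_type_cross_gap (R : realType) (M : Type) (rho : M -> M -> R)
    (k : nat) (a : 'I_k -> R) (x y : 'I_k -> M) :
  negative_type rho -> (0 < k)%N ->
  0 <= \sum_(i < k) \sum_(j < k)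
    a i * a j * cross_gap rho (x i) (x j) (y i) (y j).
Proof.
move=> neg k0.
pose glue (A : Type) (u v : 'I_k -> A) (i : 'I_(k + k)) :=
  match fintype.split i with inl j => u j | inr j => v j end.
have pickl A u v j : @glue A u v (lshift k j) = u j.
  by rewrite /glue -[lshift k j]/(unsplit (inl j)) unsplitK.
have pickr A u v j : @glue A u v (rshift k j) = v j.
  by rewrite /glue -[rshift k j]/(unsplit (inr j)) unsplitK.
(* [k >= 1] gives the required [2 <= k + k] points. *)
have := neg _ (leq_add k0 k0) (glue _ x y) (glue _ a (fun i => - a i)).
rewrite big_split_ord/=.
under eq_bigr do rewrite pickl.
under [X in _ + X = 0 -> _]eq_bigr do rewrite pickr.
rewrite sumrN subrr => /(_ erefl).
(* The double sum over [k + k] indices splits into four blocks, regrouped here under a single pair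
   [i], [j]; their signs are those of [- cross_gap]. *)
rewrite big_split_ord/= -big_split/= -oppr_ge0 -sumrN.
congr (0 <= _); apply: eq_bigr => i _.
rewrite !big_split_ord/= -!big_split -sumrN/=; apply: eq_bigr => j _.
rewrite !pickl !pickr /cross_gap; ring.
Qed.

Section autocov.
Context (R : realType) (M : pmetricType R).
Context (hTB : totally_bounded_space M) (hsep : separable_space M).
Context (d : measure_display) (T : measurableType d) (P : probability T R).

(** Taking [p] and [q] among the two projections covers all four distances between the pair and its
    copy. *)
Let integrable_sqdist_prod (U V : {RV P >-> borel_type M})
    (p q : T * T -> T) : measurable_fun setT p -> measurable_fun setT q ->
  ((P \x P)%E).-integrable setT
    (EFin \o (fun w => sqdist (U (p w) : M) (V (q w) : M))).
Proof.
by move=> mp mq; apply: integrable_sqdist => //; exact: measurableT_comp.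
Qed.

Lemma integrable_gap (U V : {RV P >-> borel_type M}) :
  ((P \x P)%E).-integrable setT 
    (EFin \o (fun w =>
      cross_gap (@sqdist R M) (U w.1) (V w.1) (U w.2) (V w.2))).
Proof.
have I p q mp mq := @integrable_sqdist_prod U V p q mp mq.
have m1 := @measurable_fst _ _ T T; have m2 := @measurable_snd _ _ T T.
exact: (integrableB measurableT (integrableB measurableT
  (integrableD measurableT (I _ _ m1 m2) (I _ _ m2 m1))
  (I _ _ m1 m1)) (I _ _ m2 m2)).
Qed.

Lemma metric_cov_gap (U V : {RV P >-> borel_type M}) :
  metric_cov P (U : T -> M) (V : T -> M) =
    4^-1 * 
    \int[(P \x P)%E]_w
      cross_gap (@sqdist R M) (U w.1) (V w.1) (U w.2) (V w.2).
Proof.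
have I p q mp mq := @integrable_sqdist_prod U V p q mp mq.
have m1 := @measurable_fst _ _ T T; have m2 := @measurable_snd _ _ T T.
rewrite /metric_cov /metric_cov_with unlock; congr (_ * _).
rewrite -[LHS]/(\int[(P \x P)%E]_w (sqdist (U w.1 : M) (V w.2 : M) +
  sqdist (U w.2 : M) (V w.1 : M) - 2 * sqdist (U w.1 : M) (V w.1 : M))).
have I1 := I _ _ m1 m1; have I2 := I _ _ m2 m2.
have I12 := integrableD measurableT (I _ _ m1 m2) (I _ _ m2 m1).
rewrite /cross_gap RintegralB//; last exact: (integrableZl measurableT 2 I1).
rewrite RintegralZl// [in RHS]RintegralB//; last first.
  exact: (integrableB measurableT I12 I1).
rewrite RintegralB//.
(* By linearity only one term still differs: the squared distance of U and V, read on the first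
   factor or on the second. *)
rewrite -(Rintegral_prod_fst_snd P (f := fun t => sqdist (U t : M) (V t : M))).
- ring.
- by apply: measurable_funX; exact: measurable_mdist.
- by move=> t; rewrite exprn_ge0// mdist_ge0.
Qed.
End autocov.

Theorem proposition1 (R : realType) (Omega : pmetricType R)
  (hTB : totally_bounded_space Omega)
  (d : measure_display) (T : measurableType d) (P : probability T R)
  (X : (`[0, 1]%classic : set R) -> {RV P >-> borel_type Omega})
  (hsep : separable_space Omega)
  (hneg : negative_type (@sqdist R Omega)) :
  nonneg_def_kernel (metric_autocov X).
Proof.
split=> [s t|k k0 a s].
  (* Symmetry holds pointwise: exchanging [s] and [t] swaps the two cross terms. *)
  rewrite /metric_autocov !metric_cov_gap//; congr (_ * _).
  apply: eq_Rintegral => w _.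
  rewrite /cross_gap !(@sqdistC _ _ (X s _)); ring.
pose g i j (w : T * T) : R := a i * a j *
  cross_gap (@sqdist R Omega) (X (s i) w.1) (X (s j) w.1)
                              (X (s i) w.2) (X (s j) w.2).
have Ig i j : ((P \x P)%E).-integrable setT (EFin \o g i j).
  exact: (integrableZl measurableT (a i * a j)
    (integrable_gap hTB hsep (X (s i)) (X (s j)))).
(* Linearity moves the quadratic form under the integral, where negative type applies at each
   [w]. *)
have -> : \sum_(i < k) \sum_(j < k) a i * a j * metric_autocov X (s i) (s j) =
    4^-1 * \int[(P \x P)%E]_w (\sum_(i < k) \sum_(j < k) g i j w).
  rewrite Rintegral_sum; last first.
    move=> i; rewrite (_ : _ \o _ = fun w => (\sum_(j < k) (g i j w)%:E)%E).
      by apply: integrable_sum => // j _; exact: Ig.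
    by apply/funext => w /=; rewrite sumEFin.
  rewrite mulr_sumr; apply: eq_bigr => i _.
  rewrite Rintegral_sum// mulr_sumr; apply: eq_bigr => j _.
  rewrite /metric_autocov metric_cov_gap// RintegralZl//.
    by rewrite mulrCA.
  exact: integrable_gap.
rewrite mulr_ge0 ?invr_ge0//; apply: Rintegral_ge0 => w _.
exact: negative_type_cross_gap.
Qed.
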